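(* Let $A,B,C\in\mathbb{M}_n$. Then there exist isometries $U_{ij}\in\mathbb{M}_{4n,n}$, $1\le i,j\le4$, such that $$|A+B|^2\oplus|B+C|^2\oplus|C+A|^2\oplus0=\frac14\sum_{j=1}^4U_{1j}|A+B+C|^2U_{1j}^*+\frac14\sum_{j=1}^4U_{2j}|A|^2U_{2j}^*+\frac14\sum_{j=1}^4U_{3j}|B|^2U_{3j}^*+\frac14\sum_{j=1}^4U_{4j}|C|^2U_{4j}^*,$$ where $0$ denotes the zero matrix in $\mathbb{M}_n$.
   Context: $\mathbb{M}_{m,n}$ is the space of $m\times n$ complex matrices, $\mathbb{M}_n=\mathbb{M}_{n,n}$; $|Z|^2=Z^*Z$. $\oplus$ denotes the block-diagonal direct sum. An isometry in $\mathbb{M}_{4n,n}$ is a matrix $V$ with $V^*V=I_n$. *)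

(* Defs.v *)
From mathcomp Require Import all_boot all_order all_algebra.
From mathcomp Require Export spectral complex reals.
Set Implicit Arguments.
Unset Strict Implicit.
Unset Printing Implicit Defensive.

Import GRing.Theory Num.Theory.
Local Open Scope ring_scope.
Local Open Scope sesquilinear_scope.

(* |Z|^2 = Z^* Z, where |Z| is the positive square root of Z^* Z. *)
Definition sqabsmx (C : numClosedFieldType) m n (Z : 'M[C]_(m, n)) : 'M[C]_n :=
  Z^t* *m Z.

(* V is tall: V^* V = 1.  The library's unitarymx is V V^* = 1, so this says
   that V^* is unitarymx. *)
Definition isometrymx (C : numClosedFieldType) m n (V : 'M[C]_(m, n)) : Prop :=
  V^t* *m V = 1%:M.

Definition dsummx (C : numClosedFieldType) m n (X : 'M[C]_m) (Y : 'M[C]_n) :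
  'M[C]_(m + n) := block_mx X 0 0 Y.

(* Main.v *)
(* Let X, Y, Z be A+B, B+C, C+A. The four block rows F = [X, +-Y, +-Z, 0] have
   Gram matrices F^* F averaging to |X|^2 (+) |Y|^2 (+) |Z|^2 (+) 0, while each
   F F^* equals X X^* + Y Y^* + Z Z^* = S S^* + A A^* + B B^* + C C^* with
   S = A+B+C. Now F^* F = T (F F^* ) T^* for an isometry T, and M M^* is
   unitarily similar to M^* M for M = S, A, B, C: for square M both are normal
   with the same characteristic polynomial. *)
Require Import Defs.
From mathcomp Require Import all_boot all_order all_algebra all_fingroup.
From mathcomp Require Import spectral complex reals.
From mathcomp Require Import ring.

Import GRing.Theory Num.Theory.
Local Open Scope ring_scope.
Local Open Scope sesquilinear_scope.
Local Open Scope complex_scope.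

(** Multiplying [K] by a block triangular matrix on the right, then by another on the left, clears
    its lower left block each time. The resulting values of ['X^n * \det K] agree, and ['X^n]
    cancels in an integral domain. *)
Lemma char_poly_mulC (R : idomainType) n (A B : 'M[R]_n) :
  char_poly (A *m B) = char_poly (B *m A).
Proof.
pose A' := map_mx (@polyC R) A; pose B' := map_mx (@polyC R) B.
pose K := block_mx ('X%:M : 'M_n) A' B' 1%:M.
have detK : \det K = char_poly (A *m B).
  have : \det (K *m block_mx 1%:M 0 (- B') 1%:M) = char_poly (A *m B).
    rewrite mulmx_block !mulmx1 !mulmx0 !mul1mx !add0r subrr det_ublock.
    by rewrite det1 mulr1 mulmxN /char_poly /char_poly_mx map_mxM.
  by rewrite det_mulmx det_lblock !det1 !mulr1.
have : \det (block_mx 1%:M 0 (- B') 'X%:M *m K) =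
       'X^n * char_poly (B *m A).
  rewrite mulmx_block !mul1mx !mul0mx !addr0 mulmx1 mulNmx.
  rewrite scalar_mxC addNr det_ublock det_scalar mulNmx addrC.
  by rewrite /char_poly /char_poly_mx map_mxM.
rewrite det_mulmx det_lblock det1 mul1r det_scalar detK.
by apply: mulfI; rewrite expf_neq0 ?polyX_eq0.
Qed.

Lemma trmxC_mul (C : numClosedFieldType) m n p
    (A : 'M[C]_(m, n)) (B : 'M[C]_(n, p)) :
  (A *m B)^t* = B^t* *m A^t*.
Proof. by rewrite trmx_mul map_mxM. Qed.

Lemma normalmx_mul_trmxC (C : numClosedFieldType) m n (A : 'M[C]_(m, n)) :
  A *m A^t* \is normalmx.
Proof. by apply/normalmxP; rewrite trmxC_mul trmxCK. Qed.

Lemma char_poly_diag (R : comNzRingType) n (d : 'rV[R]_n) :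
  char_poly (diag_mx d) = \prod_(i < n) ('X - (d 0 i)%:P).
Proof.
rewrite char_poly_trig ?diag_mx_is_trig //.
by apply: eq_bigr => i _; rewrite mxE eqxx.
Qed.

(** Both matrices are unitarily diagonalisable. Equal characteristic polynomials make the two
    diagonals agree up to a permutation, and a permutation matrix is unitary. *)
Lemma normalmx_unitarily_similar (C : numClosedFieldType) n (A B : 'M[C]_n) :
  A \is normalmx -> B \is normalmx -> char_poly A = char_poly B ->
  exists2 U : 'M[C]_n, U \is unitarymx & A = U *m B *m U^t*.
Proof.
move=> /orthomx_spectralP + /orthomx_spectralP.
move: (spectral_unitarymx A) (spectral_unitarymx B).
move: (spectralmx A) (spectral_diag A) (spectralmx B) (spectral_diag B).
move=> P d Q e Pu Qu -> ->.
(* Cycling the last factor to the front cancels the conjugation and leaves only the diagonal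
   matrices. *)
rewrite [LHS]char_poly_mulC [RHS]char_poly_mulC.
rewrite !mulKVmx ?unitarymx_unit // !char_poly_diag !invmx_unitary //.
pose seqd (f : 'rV[C]_n) := [tuple f 0 i | i < n].
have prodE (f : 'rV[C]_n) : \prod_(i < n) ('X - (f 0 i)%:P) =
    \prod_(x <- seqd f) ('X - x%:P).
  by rewrite big_tuple; apply: eq_bigr => i _; rewrite tnth_mktuple.
(* A product of monic linear factors determines its roots as a multiset, which yields the
   permutation [s]. *)
rewrite !prodE => /prod_XsubC_eq/tuple_permP[s /(@val_inj _ _ _ _ _) ds].
have {}ds i : d 0 i = e 0 (s i).
  by have := congr1 (fun t => tnth t i) ds; rewrite !tnth_mktuple.
pose S : 'M[C]_n := perm_mx s.
have St : S^t* = perm_mx s^-1 by rewrite tr_perm_mx map_perm_mx.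
have Su : S \is unitarymx.
  by apply/unitarymxP; rewrite St -perm_mxM mulgV perm_mx1.
have dE : diag_mx d = S *m diag_mx e *m S^t*.
  rewrite St -row_permE -col_permE; apply/matrixP=> i j.
  by rewrite !mxE ds (inj_eq perm_inj).
exists (P^t* *m S *m Q).
  by rewrite !mul_unitarymx ?trmxC_unitary.
rewrite dE !trmxC_mul trmxCK !mulmxA.
by rewrite (mulmxtVK _ Qu) (mulmxtVK _ Qu).
Qed.

Lemma gram_unitarily_similar (C : numClosedFieldType) n (A : 'M[C]_n) :
  exists2 U : 'M[C]_n, U \is unitarymx & A^t* *m A = U *m (A *m A^t*) *m U^t*.
Proof.
apply: normalmx_unitarily_similar; rewrite ?normalmx_mul_trmxC //.
  by rewrite -{2}[A]trmxCK normalmx_mul_trmxC.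
exact: char_poly_mulC.
Qed.

Lemma trmxC_row_mx (C : numClosedFieldType) m n1 n2
    (A : 'M[C]_(m, n1)) (B : 'M[C]_(m, n2)) :
  (row_mx A B)^t* = col_mx (A^t*) (B^t*).
Proof. by rewrite tr_row_mx map_col_mx. Qed.

Lemma trmxC_col_mx (C : numClosedFieldType) m1 m2 n
    (A : 'M[C]_(m1, n)) (B : 'M[C]_(m2, n)) :
  (col_mx A B)^t* = row_mx (A^t*) (B^t*).
Proof. by rewrite tr_col_mx map_row_mx. Qed.

Lemma trmxC0 (C : numClosedFieldType) m n : (0 : 'M[C]_(m, n))^t* = 0.
Proof. by rewrite trmx0 map_mx0. Qed.

(** Zero rows pad [F] to a square [G] with [G G^*] equal to [F F^*] bordered by zeros. Hence only
    the first [m] columns [V] of the unitary [U] for [G] contribute. *)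
Lemma gram_isometrically_similar (C : numClosedFieldType) m n
    (F : 'M[C]_(m, n)) : (m <= n)%N ->
  exists2 V : 'M[C]_(n, m), isometrymx V &
    sqabsmx F = V *m (F *m F^t*) *m V^t*.
Proof.
move=> /subnKC; move: (n - m)%N => k nE; case: _ / nE F => F {n}.
pose G : 'M[C]_(m + k) := col_mx F 0.
have [U] := gram_unitarily_similar _ _ G.
rewrite -trmxC_unitary => /unitarymxP; rewrite trmxCK.
rewrite -[U]hsubmxK; move: (lsubmx U) (rsubmx U) => V W.
(* The upper left block of [U^* U = 1] says that [V] is an isometry. *)
rewrite trmxC_row_mx mul_col_row scalar_mx_block => /eq_block_mx[Viso _ _ _].
rewrite trmxC_col_mx trmxC0 mul_row_col mulmx0 addr0 => GE.
exists V => //; rewrite /sqabsmx GE mul_col_row !mul0mx mulmx0.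
by rewrite mul_row_block !mulmx0 !addr0 mul_row_col mul0mx addr0.
Qed.

Lemma isometrymx_mul (C : numClosedFieldType) m n p
    (V : 'M[C]_(m, n)) (W : 'M[C]_(n, p)) :
  isometrymx V -> isometrymx W -> isometrymx (V *m W).
Proof.
rewrite /isometrymx => VE WE.
by rewrite trmxC_mul mulmxA -(mulmxA _ _ V) VE mulmx1.
Qed.

(** An isometry [T] carries [F F^*] to [|F|^2]. Since [Y i] is square, the same result applied to
    its adjoint turns each [Y i (Y i)^*] into a conjugate of [|Y i|^2] by some [W i]; the isometries
    sought are the [T W i]. *)
Lemma sqabsmx_isometric_sum (C : numClosedFieldType) m n k
    (F : 'M[C]_(m, n)) (Y : 'I_k -> 'M[C]_m) : (m <= n)%N ->
  F *m F^t* = \sum_i Y i *m (Y i)^t* ->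
  exists2 V : 'I_k -> 'M[C]_(n, m), forall i, isometrymx (V i) &
    sqabsmx F = \sum_i V i *m sqabsmx (Y i) *m (V i)^t*.
Proof.
move=> /(gram_isometrically_similar _ _ _ F)[T Tiso ->] ->.
have /fin_all_exists2[W Wiso YE] i : exists2 W : 'M[C]_m, isometrymx W &
    Y i *m (Y i)^t* = W *m sqabsmx (Y i) *m W^t*.
  have [W Wiso] := gram_isometrically_similar _ _ _ ((Y i)^t*) (leqnn m).
  by rewrite /sqabsmx trmxCK; exists W.
exists (fun i => T *m W i) => [i|]; first exact: isometrymx_mul.
rewrite mulmx_sumr mulmx_suml; apply: eq_bigr => i _.
by rewrite YE trmxC_mul !mulmxA.
Qed.

Lemma sqabsmx_row0 (C : numClosedFieldType) m n p (Z : 'M[C]_(m, n)) :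
  sqabsmx (row_mx Z (0 : 'M_(m, p))) = dsummx (sqabsmx Z) 0.
Proof.
by rewrite /sqabsmx trmxC_row_mx mul_col_row trmxC0 !mulmx0 mul0mx.
Qed.

(** The off-diagonal blocks change sign with [Y] and cancel. *)
Lemma sqabsmx_row_parallelogram (C : numClosedFieldType) m n p
    (X : 'M[C]_(m, n)) (Y : 'M[C]_(m, p)) :
  sqabsmx (row_mx X Y) + sqabsmx (row_mx X (- Y)) =
  dsummx (sqabsmx X) (sqabsmx Y) *+ 2.
Proof.
have NY : (- Y)^t* = - (Y^t*) by rewrite linearN /= map_mxN.
rewrite /sqabsmx !trmxC_row_mx !mul_col_row NY mulNmx !mulmxN mulNmx opprK.
by rewrite add_block_mx !subrr /dsummx mulr2n add_block_mx !addr0.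
Qed.

Lemma dsummxD (C : numClosedFieldType) m n (X X' : 'M[C]_m) (Y Y' : 'M[C]_n) :
  dsummx (X + X') (Y + Y') = dsummx X Y + dsummx X' Y'.
Proof. by rewrite /dsummx add_block_mx !addr0. Qed.

Lemma dsummxMn (C : numClosedFieldType) m n (X : 'M[C]_m) (Y : 'M[C]_n) k :
  dsummx (X *+ k) (Y *+ k) = dsummx X Y *+ k.
Proof.
elim: k => [|k IHk]; first by rewrite !mulr0n; exact: block_mx0.
by rewrite !mulrSr dsummxD IHk.
Qed.

(* The sign columns (1,1,1,1), (1,1,-1,-1), (1,-1,1,-1) are orthogonal, so the
   off-diagonal blocks of the Gram matrices cancel. *)
Lemma dsummx_sign_sum (C : numClosedFieldType) m n p q r (X : 'M[C]_(m, n))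
    (Y : 'M[C]_(m, p)) (Z : 'M[C]_(m, q)) :
  \sum_(j < 4) sqabsmx (row_mx (row_mx (row_mx X ((-1) ^+ j./2 *: Y))
     ((-1) ^+ j *: Z)) (0 : 'M_(m, r))) =
  dsummx (dsummx (dsummx (sqabsmx X) (sqabsmx Y)) (sqabsmx Z)) 0 *+ 4.
Proof.
rewrite !big_ord_recl big_ord0 /= addr0 !sqabsmx_row0.
rewrite -!(signr_odd _ (bump _ _)) /= !expr0 !expr1 !scale1r !scaleN1r.
(* Within each pair of consecutive terms only the sign of [Z] changes, and between the pairs only
   that of [Y], so the parallelogram rule applies twice. *)
rewrite addrA -!dsummxD !addr0 !sqabsmx_row_parallelogram.
rewrite -mulrnDl -dsummxD sqabsmx_row_parallelogram -mulr2n dsummxMn.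
by rewrite -mulrnA -dsummxMn mul0rn.
Qed.

Lemma mul_row_sign_trmxC (C : numClosedFieldType) m n p q r (X : 'M[C]_(m, n))
    (Y : 'M[C]_(m, p)) (Z : 'M[C]_(m, q)) k l :
  let F := row_mx (row_mx (row_mx X ((-1) ^+ k *: Y)) ((-1) ^+ l *: Z))
             (0 : 'M_(m, r)) in
  F *m F^t* = X *m X^t* + Y *m Y^t* + Z *m Z^t*.
Proof.
have signE t (W : 'M[C]_(m, t)) h :
    ((-1) ^+ h *: W) *m ((-1) ^+ h *: W)^t* = W *m W^t*.
  rewrite linearZ /= map_mxZ rmorphXn rmorphN1 -scalemxAl -scalemxAr scalerA.
  by rewrite -expr2 sqrr_sign scale1r.
by rewrite /= !trmxC_row_mx !mul_row_col !signE mul0mx addr0.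
Qed.

Theorem theorem1p37 (R : realType) (n : nat) (A B C : 'M[R[i]]_n) :
  exists U : 'I_4 -> 'I_4 -> 'M[R[i]]_(n + n + n + n, n),
    (forall i j : 'I_4, isometrymx (U i j)) /\
    dsummx (dsummx (dsummx (sqabsmx (A + B)) (sqabsmx (B + C)))
                   (sqabsmx (C + A)))
           (0 : 'M[R[i]]_n) =
      4^-1 *: (\sum_(j < 4) U 0 j *m sqabsmx (A + B + C) *m (U 0 j)^t*)
    + 4^-1 *: (\sum_(j < 4) U 1 j *m sqabsmx A *m (U 1 j)^t*)
    + 4^-1 *: (\sum_(j < 4) U 2 j *m sqabsmx B *m (U 2 j)^t*)
    + 4^-1 *: (\sum_(j < 4) U 3 j *m sqabsmx C *m (U 3 j)^t*).
Proof.
pose Y (i : 'I_4) := [:: A + B + C; A; B; C]`_i.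
pose F (j : 'I_4) := row_mx (row_mx (row_mx (A + B) ((-1) ^+ j./2 *: (B + C)))
  ((-1) ^+ j *: (C + A))) (0 : 'M[R[i]]_n).
have FE j : F j *m (F j)^t* = \sum_i Y i *m (Y i)^t*.
  rewrite mul_row_sign_trmxC !big_ord_recl big_ord0 /= /Y /= addr0.
  have trmxCD (M N : 'M[R[i]]_n) : (M + N)^t* = M^t* + N^t*.
    by rewrite linearD /= map_mxD.
  rewrite !trmxCD !mulmxDl !mulmxDr.
  (* Once the nine products are generalised, the identity is additive in them and can be checked
     entrywise. *)
  move: (A *m A^t*) (A *m B^t*) (A *m C^t*) (B *m A^t*) (B *m B^t*).
  move: (B *m C^t*) (C *m A^t*) (C *m B^t*) (C *m C^t*).
  by move=> *; apply/matrixP=> i j'; rewrite !mxE; ring.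
have le_n : (n <= n + n + n + n)%N by rewrite -!addnA leq_addr.
have /fin_all_exists2[V Viso VE] j :=
  sqabsmx_isometric_sum _ _ _ _ (F j) Y le_n (FE j).
(* [V j] comes from the sign pattern [F j], whereas the first index of [U] selects the summand
   [Y i]. *)
exists (fun i j => V j i); split=> [i j|]; first exact: Viso.
have sum4 (M : zmodType) (G : 'I_4 -> M) :
    \sum_i G i = G 0 + G 1 + G 2 + G 3.
  rewrite !big_ord_recl big_ord0 addr0 !addrA.
  by congr (_ + G _ + G _ + G _); apply: val_inj.
(* Summing over the four sign patterns gives four times the claim, whence the factor [4^-1]. *)
have VDE : \sum_i \sum_j V j i *m sqabsmx (Y i) *m (V j i)^t* =
    dsummx (dsummx (dsummx (sqabsmx (A + B)) (sqabsmx (B + C)))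
      (sqabsmx (C + A))) (0 : 'M[R[i]]_n) *+ 4.
  by rewrite -dsummx_sign_sum exchange_big; apply: eq_bigr => j _; rewrite -VE.
rewrite -!scalerDr; apply: (@scalerI _ _ 4%:R); first by rewrite pnatr_eq0.
by rewrite scaler_nat -VDE scalerA mulfV ?pnatr_eq0 // scale1r sum4.
Qed.
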